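(* Let $(X,d_X)$ and $(Y,d_Y)$ be metric spaces, let $q,r\ge0$ be real numbers, and endow $X$ and $Y$ with the closure operators $c_q$ and $c_r$, respectively. Then a map $f:X\to Y$ is continuous as a map between closure spaces $(X,c_q)\to(Y,c_r)$ if and only if it is $(q,r)$-continuous.
   Context: For a metric space $(X,d)$ and $r\ge0$, the Čech closure operator $c_r:\mathcal{P}(X)\to\mathcal{P}(X)$ is $c_r(A)=\{x\in X\mid d(x,A)\le r\}$, where $d(x,A)=\inf_{y\in A}d(x,y)$ and $c_r(\emptyset)=\emptyset$. A map $f:(X,c)\to(Y,c')$ between closure spaces is continuous iff $f(c(A))\subseteq c'(f(A))$ for all $A\subseteq X$. A map $f:(X,d_X)\to(Y,d_Y)$ is $(q,r)$-continuous if for every $\epsilon>0$ and every $x\in X$ there exists $\delta(x)>0$ such that, for all $x'\in X$, $d_X(x,x')<q+\delta(x)$ implies $d_Y(f(x),f(x'))<r+\epsilon$. *)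

(* Defs.v *)
From HB Require Import structures.
From mathcomp Require Import all_boot all_order all_algebra.
From mathcomp Require Import all_classical all_reals topology.
Set Implicit Arguments.
Unset Strict Implicit.
Unset Printing Implicit Defensive.
Import Order.TTheory GRing.Theory Num.Theory.
Local Open Scope classical_set_scope.
Local Open Scope ring_scope.

(* Čech closure operators: idempotence is not required. *)
Record closure_operator (X : Type) := ClosureOperator {
  closure_op :> set X -> set X ;
  closure_op0 : closure_op set0 = set0 ;
  closure_op_sub : forall A, A `<=` closure_op A ;
  closure_opU : forall A B,
    closure_op (A `|` B) = closure_op A `|` closure_op B }.

Definition closure_continuous (X Y : Type) (c : closure_operator X)
    (c' : closure_operator Y) (f : X -> Y) : Prop :=
  forall A : set X, f @` c A `<=` c' (f @` A).

Definition set_dist (R : realType) (X : metricType R) (x : X) (A : set X) : R :=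
  inf [set mdist x y | y in A].

(* The real infimum [inf] is 0 on the empty set, so the convention
   c_r(set0) = set0 has to be imposed through [A !=set0]. *)
Definition metric_closure (R : realType) (X : metricType R) (r : R)
    (A : set X) : set X :=
  [set x | A !=set0 /\ set_dist x A <= r].

Section metric_closure_operator.
Context (R : realType) (X : metricType R).
Implicit Types (x : X) (A B : set X) (r : R).

Lemma mdist_has_inf x A : A !=set0 -> has_inf [set mdist x y | y in A].
Proof.
move=> [a Aa]; split; first by exists (mdist x a), a.
by exists 0 => _ [y _ <-]; exact: mdist_ge0.
Qed.

Lemma set_dist_le x y A : A y -> set_dist x A <= mdist x y.
Proof.
move=> Ay; apply: ge_inf; last by exists y.
by have [] := @mdist_has_inf x A; first by exists y.
Qed.

Lemma metric_closure0 r : metric_closure r (set0 : set X) = set0.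
Proof. by apply/seteqP; split=> // x [[]]. Qed.

Lemma metric_closure_sub r A : 0 <= r -> A `<=` metric_closure r A.
Proof.
move=> r0 x Ax; split; first by exists x.
by apply: le_trans r0; rewrite -(mdistxx x); exact: set_dist_le.
Qed.

Lemma metric_closure_mono r A B :
  A `<=` B -> metric_closure r A `<=` metric_closure r B.
Proof.
move=> AB x [A0 Ar]; split; first by have [y /AB] := A0; exists y.
apply: le_trans Ar; apply: lb_le_inf; first by have [] := mdist_has_inf x A0.
by move=> _ [y /AB By <-]; exact: set_dist_le.
Qed.

Lemma not_metric_closure r A x : ~ metric_closure r A x ->
  exists2 s, r < s & forall y, A y -> s <= mdist x y.
Proof.
move=> xA; have [A0|A0] := pselect (A !=set0).
  exists (set_dist x A) => [|y]; last exact: set_dist_le.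
  by rewrite ltNge; apply/negP => Ar; apply: xA.
exists (r + 1) => [|y Ay]; first by rewrite ltrDl.
by exfalso; apply: A0; exists y.
Qed.

Lemma metric_closureU r A B :
  metric_closure r (A `|` B) = metric_closure r A `|` metric_closure r B.
Proof.
apply/seteqP; split=> x; last first.
  by case; apply: metric_closure_mono => y Cy; [left|right].
case=> AB0 ABr; apply: contrapT => /not_orP.
case=> /not_metric_closure[s rs As] /not_metric_closure[t rt Bt].
have : r < Num.min s t by rewrite lt_min rs.
rewrite ltNge => /negP; apply; apply: le_trans ABr.
apply: lb_le_inf; first by have [] := mdist_has_inf x AB0.
by move=> _ [y [/As sy|/Bt ty] <-]; rewrite ge_min ?sy ?ty ?orbT.
Qed.

End metric_closure_operator.

Definition metric_closure_operator (R : realType) (X : metricType R) (r : R)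
    (r_ge0 : 0 <= r) : closure_operator X :=
  ClosureOperator (@metric_closure0 R X r)
    (fun A => metric_closure_sub (A := A) r_ge0) (@metric_closureU R X r).

Arguments metric_closure_operator {R} X {r} r_ge0.

Definition scale_continuous (R : realType) (X Y : metricType R) (q r : R)
    (f : X -> Y) : Prop :=
  forall e : R, 0 < e -> forall x : X, exists2 d : R, 0 < d &
    forall x' : X, mdist x x' < q + d -> mdist (f x) (f x') < r + e.

(* Main.v *)
Require Import Defs.
From mathcomp Require Import all_boot all_order all_algebra.
From mathcomp Require Import all_classical all_reals topology.
Import Order.TTheory GRing.Theory Num.Theory.
Local Open Scope classical_set_scope.
Local Open Scope ring_scope.

(** A point [x] lies in [c_r(A)] exactly when every slightly enlarged ball of
    radius [r + e] around [x] meets [A] ([metric_closureP]), so both notions of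
    continuity compare enlarged balls in [X] with enlarged balls in [Y].

    If [f] is [(q, r)]-continuous and [x] is in [c_q(A)], then the [d] given for
    [e] yields a point [y] of [A] with [mdist x y < q + d], and [f y] witnesses
    that the ball of radius [r + e] around [f x] meets [f(A)].

    Conversely, given [e] and [x], closure continuity is tested on the single
    set [A] of all [y] with [r + e <= mdist (f x) (f y)]. By construction
    [f x] is not in [c_r(f(A))], hence [x] is not in [c_q(A)], so the points
    of [A] stay at distance at least some [s > q] from [x], and [s - q] is the
    required [d]. *)

(** An infimum is at most [r] exactly when it is approached by elements below
    [r + e] for every positive [e]. When [A] is empty both sides fail: the left
    one by convention, the right one because any [e] asks for a point of [A]. *)
Lemma metric_closureP (R : realType) (X : metricType R) (r : R) (A : set X)
    (x : X) :
  metric_closure r A x <->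
  forall e : R, 0 < e -> exists2 y, A y & mdist x y < r + e.
Proof.
split=> [[A0 xAr] e e0|near_A].
  have [_ [y Ay <-] ylt] := inf_adherent e0 (mdist_has_inf x A0).
  by exists y => //; apply: lt_le_trans ylt _; rewrite lerD2r.
apply: contrapT => /not_metric_closure[s rs sA].
have [|y Ay] := near_A (s - r); first by rewrite subr_gt0.
by rewrite addrC subrK ltNge sA.
Qed.

Theorem proposition3p5 (R : realType) (X Y : metricType R) (q r : R)
    (q_ge0 : 0 <= q) (r_ge0 : 0 <= r) (f : X -> Y) :
  closure_continuous (metric_closure_operator X q_ge0)
    (metric_closure_operator Y r_ge0) f <->
  scale_continuous q r f.
Proof.
split=> [fc e e0 x|fs A _ [x xA <-]].
  pose A := [set x' | r + e <= mdist (f x) (f x')].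
  have /not_metric_closure[s qs sA] : ~ metric_closure q A x.
    move=> xA; have : metric_closure r (f @` A) (f x) by apply: (fc A); exists x.
    by move=> /metric_closureP/(_ e e0)[_ [y Ay <-]]; rewrite ltNge Ay.
  exists (s - q) => [|x']; first by rewrite subr_gt0.
  rewrite addrC subrK => xx's; rewrite ltNge; apply/negP => /sA.
  by rewrite leNgt xx's.
apply/metric_closureP => e e0; have [d d0 fd] := fs e e0 x.
have [y Ay xy] := (metric_closureP _ _ _ _ _).1 xA d d0.
by exists (f y); [exists y | exact: fd].
Qed.
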